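(* Let $h\ge1$ be an integer. A perfect $B_h$ set of cardinality four exists if and only if $h\in\{1,2\}$.
   Context: Let $G$ be a finite Abelian group, written additively. A set $B=\{0,b_1,\dots,b_n\}\subseteq G$ (of cardinality $n+1$) is a $B_h$ set if all sums $\alpha_1b_1+\cdots+\alpha_nb_n$ with $\alpha_i\in\mathbb{Z}_{\ge0}$, $\sum_i\alpha_i\le h$, are distinct (for distinct coefficient vectors $(\alpha_1,\dots,\alpha_n)$). For $u\in\mathbb{R}$ put $u^+=\max\{u,0\}$; for nonnegative integers $P,Q$ let $S_n(P,Q)=\{x\in\mathbb{Z}^n:\sum_{i}x_i^+\le P,\ \sum_{i}(-x_i)^+\le Q\}$, and $S_{n,h}=S_n(\lceil h/2\rceil,\lfloor h/2\rfloor)$. To $B$ one associates the lattice $L_B=\{x\in\mathbb{Z}^n:\sum_{i=1}^n x_ib_i=0\text{ in }G\}$. A $B_h$ set $B$ of cardinality $n+1$ that generates $G$ is called perfect if $S_{n,h}+L_B$ is a lattice tiling of $\mathbb{Z}^n$ (the translates $S_{n,h}+\ell$, $\ell\in L_B$, are pairwise disjoint and cover $\mathbb{Z}^n$); equivalently, $|G|=|S_{n,h}|$. *)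

(* Defs.v *)
From mathcomp Require Import all_boot all_order all_algebra all_fingroup.

Set Implicit Arguments.
Unset Strict Implicit.
Unset Printing Implicit Defensive.

Import Order.TTheory GRing.Theory Num.Theory.
Local Open Scope ring_scope.

(** Sets [B = {0, b_1, ..., b_n}] in a finite Abelian group [G] are given by a
    family [b : 'I_n -> G]; [card_ok] makes the listed elements
    distinct. *)

Definition set_of_family (G : finZmodType) (n : nat) (b : 'I_n -> G) : {set G} :=
  0 |: [set b i | i : 'I_n].

Definition card_ok (G : finZmodType) (n : nat) (b : 'I_n -> G) : Prop :=
  #|set_of_family b| = n.+1.

Definition is_Bh (G : finZmodType) (n h : nat) (b : 'I_n -> G) : Prop :=
  forall alpha beta : {ffun 'I_n -> nat},
    (\sum_(i < n) alpha i <= h)%N -> (\sum_(i < n) beta i <= h)%N ->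
    \sum_(i < n) b i *+ alpha i = \sum_(i < n) b i *+ beta i ->
    alpha = beta.

(** The group notation [<<_>>] refers to the additive group of [G]. *)
Definition generates (G : finZmodType) (B : {set G}) : Prop :=
  <<B>>%g = [set: G].

Definition pos_part (u : int) : int := Num.max u 0.

Definition S_PQ (n P Q : nat) : pred 'rV[int]_n :=
  [pred x : 'rV[int]_n |
     (\sum_(i < n) pos_part (x 0 i) <= P%:Z) &&
     (\sum_(i < n) pos_part (- x 0 i) <= Q%:Z)].

(** [uphalf h] and [h./2] are the ceiling and the floor of [h / 2]. *)
Definition S_h (n h : nat) : pred 'rV[int]_n := @S_PQ n (uphalf h) h./2.

Definition L_of (G : finZmodType) (n : nat) (b : 'I_n -> G) : pred 'rV[int]_n :=
  [pred x : 'rV[int]_n | \sum_(i < n) b i *~ x 0 i == 0].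

Definition translate (n : nat) (S : pred 'rV[int]_n) (l : 'rV[int]_n) :
  pred 'rV[int]_n := [pred x | x - l \in S].

Definition tiling (n : nat) (S L : pred 'rV[int]_n) : Prop :=
  (forall l l', l \in L -> l' \in L -> l != l' ->
     forall x, ~~ ((x \in translate S l) && (x \in translate S l'))) /\
  (forall x, exists2 l, l \in L & x \in translate S l).

Definition perfect (G : finZmodType) (n h : nat) (b : 'I_n -> G) : Prop :=
  [/\ card_ok b, is_Bh h b, generates (set_of_family b)
    & tiling (@S_h n h) (L_of b)].

Definition perfect_Bh_set (G : finZmodType) (h m : nat) (B : {set G}) : Prop :=
  exists (n : nat) (b : 'I_n -> G),
    [/\ m = n.+1, B = set_of_family b & perfect h b].

(* Main.v *)
Require Import Defs.
From mathcomp Require Import all_boot all_order all_algebra all_fingroup.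
From mathcomp Require Import zify.
From Stdlib Require Import Classical.

(** With the extra coordinate [x0 = P - Q - sum x_i] the shape [S_3(P,Q)] becomes the
    set of integer points in [Z^4] of coordinate sum [P - Q] and positive mass at most
    [P], which is symmetric under all coordinate permutations, and a tiling lattice [M] is
    a group of sum-zero vectors of positive mass at least [P + Q + 1] ([B_h] property).

    A point just outside the shape, with positive mass [P + 1] and no zero coordinate, is
    covered by a translate whose centre has the minimal mass [P + Q + 1] and dominates the
    point coordinatewise.  Hence, when [P >= 2], each of the seven sign patterns (up to
    negation) is realised by a minimal vector.  Two minimal vectors without zero coordinates
    that are congruent modulo [2M] are equal up to sign, and [M / 2M] has at most eight
    classes, so each pattern is realised exactly once up to sign.  The unique vector of a
    pattern [(+,+,-,-)] must then cover all outer points of that pattern, which forces all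
    its coordinates to have absolute value at least [P].  Adding one or two of the three
    vectors of this kind to a minimal vector of pattern [(-,+,+,+)] yields a nonzero vector
    of [M] of mass at most [P + Q], a contradiction. *)

Set Implicit Arguments.
Unset Strict Implicit.
Unset Printing Implicit Defensive.

Import Order.TTheory GRing.Theory Num.Theory.
Local Open Scope ring_scope.

(** * Subgroups of finite rank modulo doubling *)

Lemma subgroup_mulrz (V : zmodType) (L : V -> Prop) (v : V) (k : int) :
  (forall x y, L x -> L y -> L (x - y)) -> L v -> L (v *~ k).
Proof.
move=> LB Lv; have L0 : L 0 by rewrite -(subrr v); apply: (LB).
have LN x : L x -> L (- x) by move=> Lx; rewrite -sub0r; apply: (LB).
have Ln (n : nat) : L (v *+ n).
  elim: n => [|n IHn]; first by rewrite mulr0n.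
  by rewrite mulrS -[v *+ n]opprK; apply: (LB) => //; apply: LN.
by case: (intP k) => [|n|n]; rewrite ?mulr0z // ?mulrNz; last apply: LN; apply: Ln.
Qed.

(** Euclidean descent on the absolute value of [f u]: when [f u] fails to divide some [f w], the
    remainder is again a nonzero value of [f] on [L], and a smaller one. *)
Lemma additive_image_generator (V : zmodType) (L : V -> Prop)
    (f : {additive V -> int}) (u : V) :
  (forall x y, L x -> L y -> L (x - y)) -> L u -> f u != 0 ->
  exists v, [/\ L v, f v != 0 & forall w, L w -> (f v %| f w)%Z].
Proof.
move=> LB; have [n] := ubnP (absz (f u)); elim: n u => // n IHn u le_un Lu fu0.
have [gen | /not_all_ex_not[w]] := classic (forall w, L w -> (f u %| f w)%Z).
  by exists u.
move/(imply_to_and (L w)) => [Lw /negP ndvd].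
have fr : f (w - u *~ (f w %/ f u)%Z) = (f w %% f u)%Z.
  by rewrite raddfB raddfMz /= mulrzz mulrC.
apply: (IHn (w - u *~ (f w %/ f u)%Z)).
- rewrite fr; have := ltz_mod (f w) fu0; have := modz_ge0 (f w) fu0.
  by move: le_un; lia.
- by apply: (LB) => //; exact: subgroup_mulrz.
- by rewrite fr; apply: contra ndvd => /eqP e; apply/dvdz_mod0P.
Qed.

(** Bounds the number of classes of [L] modulo [2L] by [2 ^ size fs]. Each coordinate [f] splits [L]
    into the kernel of [f] and the multiples of one vector [v]; the new bit is the parity of the
    multiple. *)
Lemma subgroup_mod2 (V : zmodType) (fs : seq {additive V -> int}) (L : V -> Prop) :
    (forall x y, L x -> L y -> L (x - y)) ->
    (forall x, L x -> all (fun f : {additive V -> int} => f x == 0) fs -> x = 0) ->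
  exists phi : V -> (size fs).-tuple bool,
    forall x y, L x -> L y -> phi x = phi y -> exists2 z, L z & x - y = z + z.
Proof.
elim: fs L => [|f fs IHfs] L LB Linj.
  exists (fun=> [tuple]) => x y Lx Ly _; exists 0; first by rewrite -(subrr x); apply: (LB).
  by rewrite (Linj x Lx isT) (Linj y Ly isT) subrr addr0.
have LB' x y : L x /\ f x = 0 -> L y /\ f y = 0 -> L (x - y) /\ f (x - y) = 0.
  by move=> [Lx fx] [Ly fy]; split; [apply: (LB) | rewrite raddfB fx fy].
have [|phi phiP] := IHfs (fun x => L x /\ f x = 0) LB'.
  by move=> x [Lx fx] fsx; apply: Linj; rewrite //= fx eqxx.
have [all0 | /not_all_ex_not[u]] := classic (forall u, L u -> f u = 0).
  exists (fun x => [tuple of false :: phi x]) => x y Lx Ly [] /val_inj e.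
  by case: (phiP x y) => //; [split; auto | split; auto | move=> z [Lz _] ?; exists z].
move/(imply_to_and (L u)) => [Lu /eqP fu0].
have [v [Lv fv0 vgen]] := additive_image_generator LB Lu fu0.
pose q x := (f x %/ f v)%Z; pose r x := x - v *~ q x.
have rL x : L x -> L (r x) /\ f (r x) = 0.
  move=> Lx; split; first by apply: (LB) => //; exact: subgroup_mulrz.
  by rewrite raddfB raddfMz /= mulrzz mulrC divzK ?subrr // vgen.
exists (fun x => [tuple of odd (absz (q x)) :: phi (r x)]) => x y Lx Ly [] eq_odd /val_inj.
case/(phiP _ _ (rL x Lx) (rL y Ly)) => z [Lz _] def_z.
have [k def_k] : exists k, q x - q y = k + k.
  by exists ((q x - q y) %/ 2)%Z; move: eq_odd; lia.
exists (z + v *~ k).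
  rewrite -[v *~ k]opprK -mulrNz; apply: (LB) => //; exact: subgroup_mulrz.
rewrite addrACA -mulrzDr -def_k -def_z /r mulrzBr opprD opprK [x - _ + _]addrACA.
by rewrite -addrA (addrACA _ (v *~ q y)) addNr subrr !addr0.
Qed.

(** * The four-coordinate model *)

Definition quad : Type := int * int * int * int.

Lemma quadB (a b c d a' b' c' d' : int) :
  (a, b, c, d) - (a', b', c', d') = (a - a', b - b', c - c', d - d') :> quad.
Proof. by []. Qed.

Lemma quadD (a b c d a' b' c' d' : int) :
  (a, b, c, d) + (a', b', c', d') = (a + a', b + b', c + c', d + d') :> quad.
Proof. by []. Qed.

Lemma quadN (a b c d : int) : - ((a, b, c, d) : quad) = (- a, - b, - c, - d).
Proof. by []. Qed.

Definition pos_mass (v : quad) : int :=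
  let: (a, b, c, d) := v in pos_part a + pos_part b + pos_part c + pos_part d.

Definition coord_sum (v : quad) : int := let: (a, b, c, d) := v in a + b + c + d.

Definition has_zero (v : quad) : bool :=
  let: (a, b, c, d) := v in [|| a == 0, b == 0, c == 0 | d == 0].

(** Invariant under negation when no coordinate is zero. *)
Definition sign_pattern (v : quad) : 3.-tuple bool :=
  let: (a, b, c, d) := v in
  [tuple (0 < a) == (0 < b); (0 < a) == (0 < c); (0 < a) == (0 < d)].

Definition between (y c : int) : Prop := (0 < y <= c) \/ (c <= y < 0).

Definition qbetween (y c : quad) : Prop :=
  let: (y0, y1, y2, y3) := y in let: (c0, c1, c2, c3) := c in
  [/\ between y0 c0, between y1 c1, between y2 c2 & between y3 c3].

(** [qt_min] makes the translates disjoint: two points of the shape differ by a vector of positive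
    mass at most [P + Q]. *)
Record quad_tiling (P Q : int) (M : quad -> Prop) : Prop := QuadTiling {
  qt_sub : forall x y, M x -> M y -> M (x - y);
  qt_sum : forall x, M x -> coord_sum x = 0;
  qt_min : forall x, M x -> x != 0 -> P + Q + 1 <= pos_mass x;
  qt_cover : forall y, coord_sum y = P - Q -> exists2 c, M c & pos_mass (y - c) <= P
}.

Definition shell (P Q : int) (y : quad) : Prop :=
  [/\ ~~ has_zero y, coord_sum y = P - Q & pos_mass y = P + 1].

Definition minvec (P Q : int) (M : quad -> Prop) (c : quad) : Prop :=
  [/\ M c, ~~ has_zero c & pos_mass c = P + Q + 1].

(** * Minimal vectors dominating the shell *)

Lemma pos_part_le (y c : int) :
  pos_part c <= pos_part y + pos_part (c - y) /\
  pos_part (- c) <= pos_part (- y) + pos_part (y - c).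
Proof. rewrite /pos_part; lia. Qed.

Lemma pos_part_between (y c : int) : y != 0 ->
  pos_part c = pos_part y + pos_part (c - y) ->
  pos_part (- c) = pos_part (- y) + pos_part (y - c) -> between y c.
Proof. rewrite /pos_part /between; lia. Qed.

Lemma pos_mass_oppE (v : quad) : pos_mass (- v) = pos_mass v - coord_sum v.
Proof. by case: v => [[[a b] c] d]; rewrite quadN /= /pos_part; lia. Qed.

Lemma pos_mass_subC (v w : quad) :
  pos_mass (w - v) = pos_mass (v - w) - coord_sum v + coord_sum w.
Proof.
case: v w => [[[a b] c] d] [[[a' b'] c'] d'].
by rewrite !quadB /= /pos_part; lia.
Qed.

(** The centre [c] covering [y] is nonzero, as [y] has mass above [P]. The triangle inequality for
    [c = y + (c - y)] bounds its mass by [(P + 1) + Q], which is also the minimum; so equality holds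
    in every coordinate. *)
Lemma shell_cover (P Q : int) M y : 0 <= P -> 0 <= Q -> quad_tiling P Q M -> shell P Q y ->
  exists2 c, minvec P Q M c & qbetween y c.
Proof.
move=> P0 Q0 MT [y0 sy py]; have [c Mc pc] := qt_cover MT sy.
have c_neq0 : c != 0.
  by apply: contraTneq pc => ->; rewrite subr0 py; lia.
have := qt_min MT Mc c_neq0; have := qt_sum MT Mc.
have := pos_mass_oppE y; have := pos_mass_oppE c; have := pos_mass_subC y c.
move: Mc c_neq0 pc py sy y0; case: y => [[[y0 y1] y2] y3].
case: c => [[[c0 c1] c2] c3]; rewrite !quadB !quadN /= => Mc _ pc py sy yn0.
move=> e1 e2 e3 sc cmin.
have [[p0 m0] [p1 m1]] := (pos_part_le y0 c0, pos_part_le y1 c1).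
have [[p2 m2] [p3 m3]] := (pos_part_le y2 c2, pos_part_le y3 c3).
have B : qbetween (y0, y1, y2, y3) (c0, c1, c2, c3).
  move: yn0 => /norP[? /norP[? /norP[? ?]]].
  by split; apply: pos_part_between => //; lia.
exists (c0, c1, c2, c3) => //; split=> //=; last by lia.
by case: B; rewrite /between => b0 b1 b2 b3; clear - b0 b1 b2 b3; lia.
Qed.

(** * Minimal vectors modulo [2M] *)

Lemma quad_eqP (x y : quad) : reflect (x = y) (x == y).
Proof. exact: eqP. Qed.

Lemma quad_double (z : quad) : pos_mass (z + z) = pos_mass z + pos_mass z.
Proof. by case: z => [[[a b] c] d]; rewrite quadD /= /pos_part; lia. Qed.

(** In absolute values, [|z| + |w| < 2 max(|z|, |w|) = |w + z| + |w - z|] when [|z|] and [|w|]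
    differ. *)
Lemma pos_part_midpoint (z w : int) : w + z != 0 -> w - z != 0 ->
  pos_part z + pos_part (- z) + (pos_part w + pos_part (- w)) <
  pos_part (w + z) + pos_part (- (w + z)) + (pos_part (w - z) + pos_part (- (w - z))).
Proof. rewrite /pos_part; lia. Qed.

Lemma pos_massN (v : quad) : coord_sum v = 0 -> pos_mass (- v) = pos_mass v.
Proof. by rewrite pos_mass_oppE => ->; rewrite subr0. Qed.

Lemma minvec_mod2_eq (P Q : int) M c c' z : 0 <= P -> 0 <= Q -> quad_tiling P Q M ->
  minvec P Q M c -> minvec P Q M c' -> M z -> c - c' = z + z -> c = c' \/ c = - c'.
Proof.
move=> P0 Q0 MT [Mc c0 pc] [Mc' c'0 pc'] Mz def_cc'.
(* [z = (c - c') / 2] and [w = (c + c') / 2] lie in [M]; if both are nonzero, comparing masses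
   contradicts [|z| + |w| < |w + z| + |w - z|] in each coordinate. *)
have [z0 | zn0] := quad_eqP z 0.
  by left; apply/eqP; rewrite -subr_eq0 def_cc' z0 addr0.
have def_c : c = (c - z) + z by rewrite subrK.
have def_c' : c' = (c - z) - z by rewrite -addrA -opprD -def_cc' subKr.
have Mw : M (c - z) by apply: (qt_sub MT).
move: (c - z) Mw def_c def_c' => w Mw def_c def_c'; subst c c' => {def_cc'}.
have [w0 | wn0] := quad_eqP w 0.
  by right; rewrite w0 !add0r opprK.
have := qt_min MT Mz (introN eqP zn0); have := qt_min MT Mw (introN eqP wn0).
have := pos_massN (qt_sum MT Mz); have := pos_massN (qt_sum MT Mw).
have := pos_massN (qt_sum MT Mc); have := pos_massN (qt_sum MT Mc').
case: z w Mz Mw Mc c0 pc Mc' c'0 pc' zn0 wn0 => [[[z0 z1] z2] z3] [[[w0 w1] w2] w3].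
rewrite quadB quadD !quadN /=.
move=> _ _ _ /norP[c0 /norP[c1 /norP[c2 c3]]] pc.
move=> _ /norP[d0 /norP[d1 /norP[d2 d3]]] pc' _ _.
have := pos_part_midpoint c0 d0; have := pos_part_midpoint c1 d1.
have := pos_part_midpoint c2 d2; have := pos_part_midpoint c3 d3.
move: pc pc'; clear; lia.
Qed.

(** Keeps minimal vectors out of the zero class, which leaves seven classes for the seven sign
    patterns. *)
Lemma minvec_not_double (P Q : int) M c z : 0 <= P -> 0 <= Q -> quad_tiling P Q M ->
  minvec P Q M c -> M z -> c <> z + z.
Proof.
move=> P0 Q0 MT [_ cn0 pc] Mz def_c.
have z0 : z != 0 by apply: contraNneq cn0 => z0; rewrite def_c z0.
by have := qt_min MT Mz z0; move: pc; rewrite def_c quad_double; lia.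
Qed.

(** * Existence and uniqueness for each sign pattern *)

Lemma sign_patternN (v : quad) : ~~ has_zero v -> sign_pattern (- v) = sign_pattern v.
Proof.
case: v => [[[a b] c] d]; rewrite quadN /= => /norP[a0 /norP[b0 /norP[c0 d0]]].
have e (u w : int) : u != 0 -> w != 0 ->
  ((0 < - u) == (0 < - w)) = ((0 < u) == (0 < w)).
  by rewrite !oppr_gt0; case: (ltgtP u 0); case: (ltgtP w 0).
by rewrite !e.
Qed.

Lemma qbetween_sign_pattern (y c : quad) : qbetween y c -> sign_pattern y = sign_pattern c.
Proof.
case: y c => [[[y0 y1] y2] y3] [[[c0 c1] c2] c3] [/= b0 b1 b2 b3].
have e (u v : int) : between u v -> (0 < u) = (0 < v).
  by rewrite /between => uv; apply/idP/idP; lia.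
by rewrite (e _ _ b0) (e _ _ b1) (e _ _ b2) (e _ _ b3).
Qed.

Lemma shell_of_pattern (P Q : int) (p : 3.-tuple bool) : 2 <= P -> 1 <= Q ->
  p != [tuple true; true; true] -> exists2 y, shell P Q y & sign_pattern y = p.
Proof.
move=> P2 Q1 p_neq.
have pE (a b c d : int) :
    ~~ has_zero (a, b, c, d) -> coord_sum (a, b, c, d) = P - Q ->
    pos_mass (a, b, c, d) = P + 1 -> sign_pattern (a, b, c, d) = p ->
    exists2 y, shell P Q y & sign_pattern y = p.
  by exists (a, b, c, d).
case/tupleP: p p_neq pE => b0 p; case/tupleP: p => b1 p; case/tupleP: p => b2 p.
rewrite (tuple0 p) => {p}.
(* Positive entries add up to [P + 1], negative ones to [- (Q + 1)]. Three entries of one sign are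
   taken positive, since [Q + 1] may be only 2. *)
case: b0 b1 b2 => [] [] [] // _ pE;
  [ apply: (pE 1 1 (P - 1) (- (Q + 1)))
  | apply: (pE 1 1 (- (Q + 1)) (P - 1))
  | apply: (pE 1 P (- Q) (- 1))
  | apply: (pE 1 (- (Q + 1)) 1 (P - 1))
  | apply: (pE 1 (- Q) P (- 1))
  | apply: (pE 1 (- Q) (- 1) P)
  | apply: (pE (- (Q + 1)) 1 1 (P - 1)) ];
  try (apply: val_inj; congr [:: _; _; _]); rewrite /= /pos_part; lia.
Qed.

Lemma minvec_of_pattern (P Q : int) M (p : 3.-tuple bool) : 2 <= P -> 1 <= Q ->
  quad_tiling P Q M -> p != [tuple true; true; true] ->
  exists2 c, minvec P Q M c & sign_pattern c = p.
Proof.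
move=> P2 Q1 MT /(shell_of_pattern P2 Q1)[y sy <-].
have [||c mc yc] := @shell_cover P Q M y _ _ MT sy; [lia | lia |].
by exists c => //; rewrite (qbetween_sign_pattern yc).
Qed.

(** Three bits suffice because a vector of sum zero is determined by its first three coordinates. *)
Lemma quad_tiling_mod2 (P Q : int) M : quad_tiling P Q M ->
  exists phi : quad -> 3.-tuple bool,
    forall x y, M x -> M y -> phi x = phi y -> exists2 z, M z & x - y = z + z.
Proof.
move=> MT.
pose fs : seq {additive quad -> int} :=
  [:: [the {additive quad -> int} of fst \o fst \o fst : quad -> int];
      [the {additive quad -> int} of snd \o fst \o fst : quad -> int];
      [the {additive quad -> int} of snd \o fst : quad -> int]].
apply: (@subgroup_mod2 _ fs); first exact: qt_sub MT.
move=> [[[a b] c] d] Mx; have := qt_sum MT Mx.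
rewrite /= => sx /and4P[/eqP a0 /eqP b0 /eqP c0 _].
by move: sx; rewrite a0 b0 c0 !add0r => ->.
Qed.

(** Zero and one chosen minimal vector per pattern lie in eight distinct classes, hence exhaust
    them; every minimal vector is then congruent to a chosen one and equals it up to sign. *)
Lemma minvec_pattern_unique (P Q : int) M c c' : 2 <= P -> 1 <= Q ->
  quad_tiling P Q M -> minvec P Q M c -> minvec P Q M c' ->
  sign_pattern c = sign_pattern c' -> c = c' \/ c = - c'.
Proof.
move=> P2 Q1 MT mc mc' eq_pat.
have [P0 Q0] : 0 <= P /\ 0 <= Q by lia.
have M0 : M 0 by case: mc => Mc _ _; rewrite -(subrr c); apply: (qt_sub MT).
have [phi phiP] := quad_tiling_mod2 MT.
(* All entries of one sign cannot occur at sum zero, so this pattern is free to index the zero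
   class. *)
pose ttt := [tuple true; true; true].
have [v vP] : exists v : 3.-tuple bool -> quad, forall p,
    if p == ttt then v p = 0 else minvec P Q M (v p) /\ sign_pattern (v p) = p.
  apply: (@fin_all_exists _ (fun _ => quad) (fun p vp =>
    if p == ttt then vp = 0 else minvec P Q M vp /\ sign_pattern vp = p)) => p.
  case: eqP => [_ | /eqP p_neq]; first by exists 0.
  by have [x] := minvec_of_pattern P2 Q1 MT p_neq; exists x.
have Mv p : M (v p) by have := vP p; case: eqP => [_ -> // | _ [[]]].
have eq_v x p : minvec P Q M x -> phi x = phi (v p) ->
    p != ttt /\ (x = v p \/ x = - v p).
  move=> mx eq_phi; have [Mx _ _] := mx.
  have [z Mz def_z] := phiP _ _ Mx (Mv p) eq_phi.
  have := vP p; case: eqP => [p_ttt vp0 | _ [mvp _]].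
    by rewrite vp0 subr0 in def_z; case: (minvec_not_double P0 Q0 MT mx Mz def_z).
  by split=> //; apply: minvec_mod2_eq P0 Q0 MT mx mvp Mz def_z.
have minvN x : minvec P Q M x -> sign_pattern (- x) = sign_pattern x.
  by case=> _ xn0 _; apply: sign_patternN.
have eq_p x p : minvec P Q M x -> phi x = phi (v p) -> sign_pattern x = p.
  move=> mx /(eq_v _ _ mx)[p_neq]; have := vP p.
  by rewrite (negPf p_neq) => -[mvp pat_vp] [-> | ->]; rewrite ?minvN.
have inj_phi_v : injective (phi \o v).
  move=> p p' /= eq_phi; have := vP p; case: eqP => [p_ttt vp0 | _ [mvp pat_vp]].
    apply/esym; have := vP p'; case: eqP => [-> // | _ [mvp' _]].
    by have [/negP] := eq_v _ _ mvp' (esym eq_phi); rewrite p_ttt eqxx.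
  by rewrite -pat_vp; apply: eq_p.
have onto x : exists p, phi x = phi (v p).
  by have /codomP[p ->] := inj_card_onto inj_phi_v (leqnn _) (phi x); exists p.
have [[p phi_c] [p' phi_c']] := (onto c, onto c').
have def_p := eq_p _ _ mc phi_c; have def_p' := eq_p _ _ mc' phi_c'.
have eq_pp' : p = p' by rewrite -def_p -def_p'.
have [_ c_v] := eq_v _ _ mc phi_c; have [_ c'_v] := eq_v _ _ mc' phi_c'.
rewrite -eq_pp' in c'_v.
by case: c_v c'_v => -> [] ->; rewrite ?opprK; auto.
Qed.

Lemma shell_qbetween (P Q : int) M c y : 2 <= P -> 1 <= Q ->
  quad_tiling P Q M -> minvec P Q M c -> shell P Q y ->
  sign_pattern y = sign_pattern c -> qbetween y c \/ qbetween y (- c).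
Proof.
move=> P2 Q1 MT mc sy eq_pat.
have [||c' mc' yc'] := @shell_cover P Q M y _ _ MT sy; [lia | lia |].
have eq_pat' : sign_pattern c' = sign_pattern c.
  by rewrite -eq_pat (qbetween_sign_pattern yc').
have [def_c | def_c] := minvec_pattern_unique P2 Q1 MT mc' mc eq_pat';
  by rewrite def_c in yc'; auto.
Qed.

(** * Minimal vectors of prescribed shape *)

Lemma minvecN (P Q : int) M c : quad_tiling P Q M -> minvec P Q M c -> minvec P Q M (- c).
Proof.
move=> MT [Mc c0 pc]; split.
- by rewrite -sub0r -(subrr c); do 2?[apply: (qt_sub MT) => //].
- by case: c c0 {Mc pc} => [[[a b] c] d]; rewrite quadN /= !oppr_eq0.
- by rewrite pos_massN // (qt_sum MT).
Qed.

Lemma balanced_minvec (P Q : int) M : 2 <= P -> 1 <= Q -> quad_tiling P Q M ->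
  exists a b c d : int,
    [/\ M (a, b, - c, - d), a + b = P + Q + 1, c + d = P + Q + 1,
        P <= a /\ P <= b & P <= c /\ P <= d].
Proof.
move=> P2 Q1 MT.
have [//|c0 mc0 pat_c0] := @minvec_of_pattern P Q M [tuple true; false; false] P2 Q1 MT.
have [c [mc pat_c c_pos]] : exists c, [/\ minvec P Q M c,
    sign_pattern c = [tuple true; false; false] & 0 < c.1.1.1].
  have [c0_pos | c0_npos] := boolP (0 < c0.1.1.1); first by exists c0.
  exists (- c0); split; [exact: minvecN | | ].
    by case: mc0 => _ c0n0 _; rewrite sign_patternN.
  case: mc0 c0_npos => _ + _; case: c0 {pat_c0} => [[[a b] c] d] /=.
  by rewrite oppr_gt0 -leNgt lt_neqAle => /norP[-> _] ->.
have shellP (y0 y1 y2 y3 : int) : ~~ has_zero (y0, y1, y2, y3) ->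
    y0 + y1 + y2 + y3 = P - Q -> pos_mass (y0, y1, y2, y3) = P + 1 ->
    [/\ (0 < y0) == (0 < y1), (0 < y0) != (0 < y2) & (0 < y0) != (0 < y3)] ->
    qbetween (y0, y1, y2, y3) c \/ qbetween (y0, y1, y2, y3) (- c).
  move=> y0n sy py [e1 e2 e3]; apply: shell_qbetween P2 Q1 MT mc _ _; first by split.
  by rewrite pat_c /= e1 (negPf e2) (negPf e3).
(* Each of these four points has the entry [P] in a different coordinate. It is dominated by [c] or
   [- c], the sign being fixed by [0 < a], so that coordinate of [c] is at least [P] in absolute
   value. *)
have [s1 s2] := (shellP P 1 (- Q) (- 1), shellP 1 P (- 1) (- Q)).
have [s3 s4] := (shellP (- Q) (- 1) P 1, shellP (- 1) (- Q) 1 P).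
case: mc => Mc cn0 pc; have := qt_sum MT Mc.
case: c Mc cn0 pc c_pos pat_c {shellP} s1 s2 s3 s4 => [[[a b] c] d].
rewrite quadN /= /between /pos_part => Mc cn0 pc a_pos [eb ec ed] s1 s2 s3 s4 sc.
have c_neg : c < 0 by move: cn0 a_pos ec; clear; lia.
have Pa : P <= a.
  by case: s1; [lia.. | by split; lia | case; lia | case; lia].
have Pb : P <= b.
  by case: s2; [lia.. | by split; lia | case; lia | case; lia].
have Pc : P <= - c.
  by case: s3; [lia.. | by split; lia | case; lia | case; lia].
have Pd : P <= - d.
  by case: s4; [lia.. | by split; lia | case; lia | case; lia].
exists a, b, (- c), (- d); rewrite !opprK.
by split=> //; move: pc sc Pa Pb Pc Pd; clear -P2; lia.
Qed.

(** A minimal vector dominating a shell point whose only negative entry is the first has its whole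
    negative mass [P + Q + 1] there. *)
Lemma lone_minvec (P Q : int) M : 2 <= P -> 1 <= Q -> quad_tiling P Q M ->
  exists p q s : int,
    [/\ M (- (P + Q + 1), p, q, s), p + q + s = P + Q + 1 & 1 <= p /\ 1 <= q /\ 1 <= s].
Proof.
move=> P2 Q1 MT; have [P0 Q0] : 0 <= P /\ 0 <= Q by lia.
have [|c mc] := @shell_cover P Q M (- (Q + 1), 1, 1, P - 1) P0 Q0 MT.
  by split; rewrite /= /pos_part; lia.
case: mc => Mc cn0 pc; have := qt_sum MT Mc.
case: c Mc cn0 pc => [[[a b] c] d] Mc _ /= pc sc [b0 b1 b2 b3].
have def_a : a = - (P + Q + 1).
  by move: pc sc b0 b1 b2 b3; rewrite /between /pos_part; clear - P2 Q1; lia.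
exists b, c, d; rewrite -def_a; split=> //.
  by move: sc; rewrite def_a; clear; lia.
by move: b1 b2 b3; rewrite /between; clear - P2; lia.
Qed.

(** * Coordinate swaps and the contradiction *)

Lemma quad_tiling_involution (P Q : int) M (f : quad -> quad) :
  (forall x y, f (x - y) = f x - f y) -> involutive f ->
  (forall x, coord_sum (f x) = coord_sum x) -> (forall x, pos_mass (f x) = pos_mass x) ->
  quad_tiling P Q M -> quad_tiling P Q (fun x => M (f x)).
Proof.
move=> fB fK f_sum f_mass MT.
have f0 : f 0 = 0 by rewrite -[X in f X](subrr 0) fB subrr.
split.
- by move=> x y Mx My; rewrite fB; apply: (qt_sub MT).
- by move=> x /(qt_sum MT); rewrite f_sum.
- move=> x Mx x0; rewrite -f_mass; apply: (qt_min MT) => //.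
  by rewrite -(inj_eq (can_inj fK)) f0 fK.
- move=> y; rewrite -f_sum => /(qt_cover MT)[c Mc pc].
  by exists (f c); rewrite ?fK // -f_mass fB fK.
Qed.

Lemma no_quad_tiling (P Q : int) M : 2 <= P -> Q <= P <= Q + 1 -> ~ quad_tiling P Q M.
Proof.
move=> P2 PQ MT; have Q1 : 1 <= Q by lia.
have MD (a b c d a' b' c' d' : int) : M (a, b, c, d) -> M (a', b', c', d') ->
    M (a + a', b + b', c + c', d + d').
  rewrite -quadD; move: (_, d) (_, d') => x y Mx My.
  rewrite -[y]opprK; apply: (qt_sub MT) => //.
  by rewrite -sub0r -(subrr y); do 2?apply: (qt_sub MT).
pose swap12 (v : quad) : quad := let: (a, b, c, d) := v in (a, c, b, d).
pose swap13 (v : quad) : quad := let: (a, b, c, d) := v in (a, d, c, b).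
have MT12 : quad_tiling P Q (fun v => M (swap12 v)).
  apply: quad_tiling_involution MT.
  - by move=> [[[? ?] ?] ?] [[[? ?] ?] ?].
  - by move=> [[[? ?] ?] ?].
  - by move=> [[[? ?] ?] ?] /=; lia.
  - by move=> [[[? ?] ?] ?] /=; lia.
have MT13 : quad_tiling P Q (fun v => M (swap13 v)).
  apply: quad_tiling_involution MT.
  - by move=> [[[? ?] ?] ?] [[[? ?] ?] ?].
  - by move=> [[[? ?] ?] ?].
  - by move=> [[[? ?] ?] ?] /=; lia.
  - by move=> [[[? ?] ?] ?] /=; lia.
have [a1 [b1 [c1 [d1 [M1 s1 s1' [Pa1 Pb1] [Pc1 Pd1]]]]]] := balanced_minvec P2 Q1 MT.
have [a2 [b2 [c2 [d2 [/= M2 s2 s2' [Pa2 Pb2] [Pc2 Pd2]]]]]] := balanced_minvec P2 Q1 MT12.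
have [a3 [b3 [c3 [d3 [/= M3 s3 s3' [Pa3 Pb3] [Pc3 Pd3]]]]]] := balanced_minvec P2 Q1 MT13.
have [p [q [s [Mt st [p1 [q1 r1]]]]]] := lone_minvec P2 Q1 MT.
have bound (x y z w : int) : M (x, y, z, w) -> y != 0 \/ z != 0 \/ w != 0 ->
    P + Q + 1 <= pos_part x + pos_part y + pos_part z + pos_part w.
  move=> Mv nz; apply: (qt_min MT Mv); apply/eqP => -[_ y0 z0 w0].
  by case: nz => [|[]]; rewrite ?y0 ?z0 ?w0 eqxx.
have h1 := bound _ _ _ _ (MD _ _ _ _ _ _ _ _ Mt M1).
have h2 := bound _ _ _ _ (MD _ _ _ _ _ _ _ _ Mt M2).
have h3 := bound _ _ _ _ (MD _ _ _ _ _ _ _ _ Mt M3).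
have h12 := bound _ _ _ _ (MD _ _ _ _ _ _ _ _ (MD _ _ _ _ _ _ _ _ Mt M1) M2).
have h13 := bound _ _ _ _ (MD _ _ _ _ _ _ _ _ (MD _ _ _ _ _ _ _ _ Mt M1) M3).
have h23 := bound _ _ _ _ (MD _ _ _ _ _ _ _ _ (MD _ _ _ _ _ _ _ _ Mt M2) M3).
clear bound Mt M1 M2 M3 MT12 MT13 MD swap12 swap13 MT M.
(* The first coordinate of the sum is [a1 - (P + Q + 1) = - b1], so it adds no positive mass. *)
have {}h1 : P + Q + 1 <= p + b1 + pos_part (q - c1) + pos_part (s - d1).
  by move: h1; rewrite /pos_part; clear -P2 PQ s1 Pa1 Pb1 p1; lia.
have {}h2 : P + Q + 1 <= pos_part (p - c2) + (q + b2) + pos_part (s - d2).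
  by move: h2; rewrite /pos_part; clear -P2 PQ s2 Pa2 Pb2 q1; lia.
have {}h3 : P + Q + 1 <= pos_part (p - d3) + pos_part (q - c3) + (s + b3).
  by move: h3; rewrite /pos_part; clear -P2 PQ s3 Pa3 Pb3 r1; lia.
(* [h1] amounts to [min(q, c1) + min(s, d1) <= b1 <= Q + 1]. If [q] and [s] exceed 1, this forces
   [q + s <= Q + 1], hence [p >= P]. By symmetry, two entries above 1 would make all three at least
   [P], against [3P > P + Q + 1]. *)
have two_small : [|| (p <= 1) && (q <= 1), (p <= 1) && (s <= 1) | (q <= 1) && (s <= 1)].
  by move: h1 h2 h3; rewrite /pos_part; clear h12 h13 h23; lia.
(* The entries of the balanced vectors lie between [P] and [Q + 1], so they nearly cancel. The
   remaining large entry [P + Q - 1] loses at least [2P] and turns negative. *)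
case/or3P: two_small => /andP[x1 y1].
- by move: h12; rewrite /pos_part; clear h1 h2 h3 h13 h23; lia.
- by move: h13; rewrite /pos_part; clear h1 h2 h3 h12 h23; lia.
- by move: h23; rewrite /pos_part; clear h1 h2 h3 h12 h13; lia.
Qed.

(** * From perfect [B_h] sets to the four-coordinate model *)

(** The positive and negative parts of a relation are admissible coefficient vectors with the same
    sum; the [B_h] property equates them, and their supports are disjoint. *)
Lemma Bh_lattice_min (G : finZmodType) (n h : nat) (b : 'I_n -> G) (x : 'rV[int]_n) :
  is_Bh h b -> x \in L_of b -> \sum_(i < n) pos_part (x 0 i) <= h%:Z ->
  \sum_(i < n) pos_part (- x 0 i) <= h%:Z -> x = 0.
Proof.
move=> bBh /eqP Lx pos_le neg_le.
have absE (u : int) : (absz (pos_part u))%:Z = pos_part u by rewrite /pos_part; lia.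
have ffun_le (f : 'I_n -> int) : \sum_(i < n) pos_part (f i) <= h%:Z ->
    (\sum_(i < n) [ffun i => absz (pos_part (f i))] i <= h)%N.
  move=> le_h; rewrite -lez_nat (_ : Posz _ = \sum_(i < n) pos_part (f i)) //.
  rewrite -[LHS]intz sumMz; apply: eq_bigr => i _.
  by rewrite ffunE intz absE.
have eq_parts : [ffun i => absz (pos_part (x 0 i))] = [ffun i => absz (pos_part (- x 0 i))].
  apply: bBh (ffun_le _ pos_le) (ffun_le _ neg_le) _; apply/eqP.
  rewrite -subr_eq0 -sumrB -[X in _ == X]Lx; apply/eqP/eq_bigr => i _.
  by rewrite !ffunE !pmulrn !absE -mulrzBr /pos_part; congr (_ *~ _); lia.
apply/rowP => i; move/ffunP/(_ i): eq_parts; rewrite !ffunE mxE => /(congr1 Posz).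
by rewrite !absE /pos_part; lia.
Qed.

Definition row3 (a b c : int) : 'rV[int]_3 := \row_(i < 3) nth 0 [:: a; b; c] i.

Lemma sum_row3 (V : nmodType) (F : int -> V) (a b c : int) :
  \sum_(i < 3) F (row3 a b c 0 i) = F a + F b + F c.
Proof. by rewrite !big_ord_recr big_ord0 /= !mxE /= add0r. Qed.

Lemma row3B (a b c a' b' c' : int) :
  row3 (a - a') (b - b') (c - c') = row3 a b c - row3 a' b' c'.
Proof. by apply/rowP => i; rewrite !mxE; case: i => [[|[|[|]]] ?]. Qed.

Lemma row3_eq (x : 'rV[int]_3) : exists a b c, x = row3 a b c.
Proof.
exists (x 0 0), (x 0 1), (x 0 2%:R); apply/rowP => i; rewrite !mxE.
by case: i => [[|[|[|]]] ?] //=; congr (x 0 _); apply: val_inj.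
Qed.

Lemma L_of_sub (G : finZmodType) (n : nat) (b : 'I_n -> G) (x y : 'rV[int]_n) :
  x \in L_of b -> y \in L_of b -> x - y \in L_of b.
Proof.
move=> /eqP Lx /eqP Ly; apply/eqP.
transitivity (\sum_(i < n) b i *~ x 0 i - \sum_(i < n) b i *~ y 0 i).
  by rewrite -sumrB; apply: eq_bigr => i _; rewrite !mxE mulrzBr.
by rewrite Lx Ly subrr.
Qed.

(** Completing a lattice vector to sum zero makes its positive and negative masses agree, so one
    bound by [h = P + Q] controls both parts. *)
Lemma perfect_quad_tiling (G : finZmodType) (h : nat) (b : 'I_3 -> G) : perfect h b ->
  quad_tiling (uphalf h)%:Z (h./2)%:Z
    (fun v => let: (x0, x1, x2, x3) := v in
      x0 + x1 + x2 + x3 = 0 /\ row3 x1 x2 x3 \in L_of b).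
Proof.
move=> [_ bBh _ [_ cover]]; have hPQ : (uphalf h)%:Z + (h./2)%:Z = h%:Z by lia.
have sum_pos := sum_row3 pos_part; have sum_neg := sum_row3 (fun u => pos_part (- u)).
split.
- move=> [[[x0 x1] x2] x3] [[[y0 y1] y2] y3] [sx Lx] [sy Ly]; rewrite quadB.
  by split; [lia | rewrite row3B; apply: L_of_sub].
- by move=> [[[x0 x1] x2] x3] [].
- move=> [[[x0 x1] x2] x3] [sx Lx]; rewrite hPQ; apply: contra_neqT => small.
  have /rowP x_eq0 : row3 x1 x2 x3 = 0.
    apply: Bh_lattice_min bBh Lx _ _; rewrite ?sum_pos ?sum_neg.
      by move: small sx; rewrite /= /pos_part; clear; lia.
    by move: small sx; rewrite /= /pos_part; clear; lia.
  have := (x_eq0 0, x_eq0 1, x_eq0 2%:R); rewrite !mxE /= => -[[x10 x20] x30].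
  by move: sx; rewrite x10 x20 x30 !addr0 => ->.
- move=> [[[y0 y1] y2] y3] sy; have [l Ll] := cover (row3 y1 y2 y3).
  have [c1 [c2 [c3 def_l]]] := row3_eq l.
  rewrite inE def_l -row3B => /andP[]; rewrite sum_pos sum_neg => pos_le neg_le.
  exists (- (c1 + c2 + c3), c1, c2, c3); first by split; [lia | rewrite -def_l].
  by move: sy pos_le neg_le; rewrite quadB /= /pos_part; clear; lia.
Qed.

Lemma perfect_B4_small (G : finZmodType) (h : nat) (B : {set G}) :
  perfect_Bh_set h 4 B -> (h <= 2)%N.
Proof.
move=> [n [b [[eq_n] _]]]; case: n / eq_n b => b /perfect_quad_tiling b_tiling.
rewrite leqNgt; apply/negP => h_ge3; apply: no_quad_tiling b_tiling; lia.
Qed.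

(** * Perfect sets for [h = 1] and [h = 2] *)

Lemma generates_of_spanning (G : finZmodType) (n : nat) (b : 'I_n -> G) :
  (forall g : G, exists s : 'rV[int]_n, \sum_(i < n) b i *~ s 0 i = g) ->
  generates (set_of_family b).
Proof.
move=> span; apply/setP => g; rewrite in_setT; have [s <-] := span g.
have natgen i m : b i *+ m \in <<set_of_family b>>%g.
  by rewrite -FinRing.zmodXgE groupX // mem_gen // !inE imset_f ?orbT.
elim/big_ind: _ => [||i _]; [exact: group1 | by move=> x y; apply: groupM |].
case: (intP (s 0 i)) => [|m|m]; first by rewrite mulr0z; apply: group1.
  exact: natgen.
by rewrite mulrNz -FinRing.zmodVgE groupV; apply: natgen.
Qed.

(** Unit coefficient vectors have sum [1 <= h], so the [B_h] property separates the [b i] from each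
    other and from 0. *)
Lemma Bh_card_ok (G : finZmodType) (n h : nat) (b : 'I_n -> G) :
  (0 < h)%N -> is_Bh h b -> card_ok b.
Proof.
move=> h_gt0 bBh.
pose delta (i : 'I_n) := [ffun j : 'I_n => (j == i : nat)].
have delta_le i : (\sum_(j < n) delta i j <= h)%N.
  rewrite (bigD1 i) //= ffunE eqxx big1 => [|j /negPf ji]; last by rewrite ffunE ji.
  by rewrite addn0.
have delta_sum i : \sum_(j < n) b j *+ delta i j = b i.
  rewrite (bigD1 i) //= ffunE eqxx mulr1n big1 => [|j /negPf ji]; last by rewrite ffunE ji.
  by rewrite addr0.
rewrite /card_ok cardsU1 card_imset; last first.
  move=> i j eq_b; have /ffunP/(_ i) : delta i = delta j.
    by apply: bBh => //; rewrite !delta_sum.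
  by rewrite !ffunE eqxx; case: eqP.
rewrite card_ord; case: imsetP => // -[i _ bi0].
have /ffunP/(_ i) : delta i = [ffun=> 0%N].
  apply: bBh => //; first by rewrite big1 // => j _; rewrite ffunE.
  by rewrite delta_sum -bi0 big1 // => j _; rewrite ffunE.
by rewrite !ffunE eqxx.
Qed.

(** Overlapping translates would give a lattice vector with both masses at most [P + Q = h], hence
    zero. For covering, subtract from [x] a point of the shape with the same value in [G]. *)
Lemma perfect_of_Bh_cover (G : finZmodType) (n h : nat) (b : 'I_n -> G) :
  (0 < h)%N -> is_Bh h b ->
  (forall g : G, exists2 s, s \in @S_h n h & \sum_(i < n) b i *~ s 0 i = g) ->
  perfect h b.
Proof.
move=> h_gt0 bBh cover; split=> //.
- exact: Bh_card_ok bBh.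
- by apply: generates_of_spanning => g; have [s _] := cover g; exists s.
have hPQ : (uphalf h)%:Z + (h./2)%:Z = h%:Z by lia.
have pos_sub (u v : int) : pos_part (u - v) <= pos_part u + pos_part (- v).
  by rewrite /pos_part; lia.
have neg_sub (u v : int) : pos_part (- (u - v)) <= pos_part (- u) + pos_part v.
  by rewrite /pos_part; lia.
split.
  move=> l l' Ll Ll' neq_ll' x; apply: contra_neqN neq_ll' => /andP[].
  rewrite !inE => /andP[pos_s neg_s] /andP[pos_s' neg_s'].
  apply/eqP; rewrite -subr_eq0; apply/eqP.
  have def_d : l - l' = (x - l') - (x - l) by rewrite opprB [RHS]addrC addrA subrK.
  apply: Bh_lattice_min bBh (L_of_sub Ll Ll') _ _; rewrite -hPQ def_d.
    apply: le_trans (lerD pos_s' neg_s); rewrite -big_split /=.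
    by apply: ler_sum => i _; rewrite [(_ - (x - l)) 0 i]mxE [(- (x - l)) 0 i]mxE pos_sub.
  rewrite [leRHS]addrC; apply: le_trans (lerD neg_s' pos_s); rewrite -big_split /=.
  apply: ler_sum => i _; rewrite [(_ - (x - l)) 0 i]mxE [(- (x - l)) 0 i]mxE.
  by rewrite neg_sub.
move=> x; have [s Ss sum_s] := cover (\sum_(i < n) b i *~ x 0 i).
exists (x - s); last by rewrite inE subKr.
rewrite inE -[X in _ == X](subrr (\sum_(i < n) b i *~ x 0 i)) -{2}sum_s -sumrB.
by apply/eqP/eq_bigr => i _; rewrite !mxE mulrzBr.
Qed.

(** Reduces perfection to integer arithmetic and a finite table; [q] counts the multiples of [m]. *)
Lemma perfect_Zp (m h c0 c1 c2 : nat) : (1 < m)%N -> (0 < h)%N ->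
  (forall x0 x1 x2 y0 y1 y2 : nat, x0 + x1 + x2 <= h -> y0 + y1 + y2 <= h ->
    c0 * x0 + c1 * x1 + c2 * x2 = c0 * y0 + c1 * y1 + c2 * y2 %[mod m] ->
    [/\ x0 = y0, x1 = y1 & x2 = y2])%N ->
  (forall k : nat, (k < m)%N -> exists z0 z1 z2 q : int,
    [/\ pos_part z0 + pos_part z1 + pos_part z2 <= (uphalf h)%:Z,
        pos_part (- z0) + pos_part (- z1) + pos_part (- z2) <= (h./2)%:Z
      & c0%:Z * z0 + c1%:Z * z1 + c2%:Z * z2 = k%:Z + q * m%:Z]) ->
  perfect h (fun i : 'I_3 => (nth 0%N [:: c0; c1; c2] i)%:R : 'Z_m).
Proof.
move=> m_gt1 h_gt0 inj_c cover_c; apply: perfect_of_Bh_cover => //.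
  move=> alpha beta; rewrite !big_ord_recl !big_ord0 /= !addn0 !addr0 !addnA !addrA.
  rewrite -!mulrnA -!mulrnDr => le_alpha le_beta /(congr1 (@nat_of_ord _)).
  rewrite !val_Zp_nat // => /(inj_c _ _ _ _ _ _ le_alpha le_beta)[e0 e1 e2].
  apply/ffunP => -[[|[|[|]]] // lt_i]; [move: e0 | move: e1 | move: e2].
  - by rewrite (_ : ord0 = Ordinal lt_i) //; apply: val_inj.
  - by rewrite (_ : lift ord0 ord0 = Ordinal lt_i) //; apply: val_inj.
  - by rewrite (_ : lift ord0 (lift ord0 ord0) = Ordinal lt_i) //; apply: val_inj.
move=> g; have g_lt : (g < m)%N by have := ltn_ord g; rewrite [X in (_ < X)%N]Zp_cast.
have [z0 [z1 [z2 [q [pos_le neg_le def_g]]]]] := cover_c g g_lt.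
exists (row3 z0 z1 z2).
  by rewrite inE (sum_row3 pos_part) (sum_row3 (fun u => pos_part (- u))) pos_le.
have scaleE (c : nat) (z : int) : c%:R *~ z = (c%:Z * z)%:~R :> 'Z_m.
  by rewrite intrM mulrzr.
rewrite !big_ord_recr big_ord0 /= !mxE /= add0r !scaleE -!intrD def_g intrD intrM.
by rewrite -!pmulrn pchar_Zp // mulr0 addr0 natr_Zp.
Qed.

Lemma perfect_B1 : perfect 1 (fun i : 'I_3 => (nth 0%N [:: 1; 2; 3]%N i)%:R : 'Z_4).
Proof.
apply: perfect_Zp => // [x0 x1 x2 y0 y1 y2 lex ley eq_mod|[|[|[|[|]]]] // _].
- by move: eq_mod; split; lia.
- by exists 0, 0, 0, 0.
- by exists 1, 0, 0, 0.
- by exists 0, 1, 0, 0.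
- by exists 0, 0, 1, 0.
Qed.

(** [{0, 1, 3, 9}] is a perfect difference set modulo 13. *)
Lemma perfect_B2 : perfect 2 (fun i : 'I_3 => (nth 0%N [:: 1; 3; 9]%N i)%:R : 'Z_13).
Proof.
apply: perfect_Zp => // [x0 x1 x2 y0 y1 y2 lex ley eq_mod|].
  by move: eq_mod; split; lia.
move=> [|[|[|[|[|[|[|[|[|[|[|[|[|]]]]]]]]]]]]] // _.
(* The rows write the residues 0 to 12 in turn as differences of two elements of [{0, 1, 3, 9}],
   with the multiple of 13 last. *)
- by exists 0, 0, 0, 0.
- by exists 1, 0, 0, 0.
- by exists (- 1), 1, 0, 0.
- by exists 0, 1, 0, 0.
- by exists 0, 0, (- 1), (- 1).
- by exists 1, 0, (- 1), (- 1).
- by exists 0, (- 1), 1, 0.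
- by exists 0, 1, (- 1), (- 1).
- by exists (- 1), 0, 1, 0.
- by exists 0, 0, 1, 0.
- by exists 0, (- 1), 0, (- 1).
- by exists 1, (- 1), 0, (- 1).
- by exists (- 1), 0, 0, (- 1).
Qed.

Local Close Scope ring_scope.

Theorem corollary6p2 (h : nat) (h_ge1 : 1 <= h) :
  (exists (G : finZmodType) (B : {set G}), perfect_Bh_set h 4 B) <->
  (h = 1 \/ h = 2).
Proof.
split=> [[G [B /perfect_B4_small]] | [] ->]; first by lia.
  by exists 'Z_4; eexists; exists 3; eexists; split; [| | exact: perfect_B1].
by exists 'Z_13; eexists; exists 3; eexists; split; [| | exact: perfect_B2].
Qed.
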